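(* Consider an algorithm that is an instance of the geometric model, with finite iteration space $\mathcal{Z}\subseteq\mathbb{Z}^d$, arrays $A_1,\ldots,A_m$ and subscript maps $\phi_1,\ldots,\phi_m$, and consider any $M$-fit, legal sequential execution of it which contains no paired Allocate/Free statements of array variables. Suppose that the linear constraints on $s\in[0,1]^m$ $$\operatorname{rank}(H)\le\sum_{j=1}^m s_j\operatorname{rank}(\phi_j(H))\qquad\text{for all subgroups } H\le\mathbb{Z}^d \tag{A}$$ are feasible. Then, for sufficiently large $|\mathcal{Z}|$, the number of Reads/Writes in the execution is $\Omega\big(|\mathcal{Z}|/M^{s_{\mathrm{HBL}}-1}\big)$, where $s_{\mathrm{HBL}}$ is the minimum value of $\sum_{j=1}^m s_j$ over $s\in[0,1]^m$ subject to (A).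
   Context: **Geometric model.** An instance is an abstract algorithm of the form: for all $\mathcal{I}\in\mathcal{Z}\subseteq\mathbb{Z}^d$, in some order, run $\text{inner\_loop}(\mathcal{I},(A_1,\ldots,A_m),(\phi_1,\ldots,\phi_m))$. Here each $\phi_j\colon\mathbb{Z}^d\to\mathbb{Z}^{d_j}$ is a $\mathbb{Z}$-affine map and each $A_j\colon\phi_j(\mathbb{Z}^d)\to\{\text{variables}\}$ is an injection; different arrays may overlap (alias). The subroutine inner_loop accesses every variable $A_1(\phi_1(\mathcal{I})),\ldots,A_m(\phi_m(\mathcal{I}))$ (the array variables), as input, output or both, in every iteration $\mathcal{I}\in\mathcal{Z}$. Translations may be absorbed into the injections $A_j$, so in the rank constraints (A) each $\phi_j$ is taken to be linear (i.e. replaced by its linear part). It is assumed that $d>0$ and $m>0$. The rank of an Abelian group is the cardinality of a maximal $\mathbb{Z}$-linearly independent subset. **Machine.** There is a slow memory of unbounded capacity and a fast memory that stores $M$ words; all data are one word wide. Every storage location has a unique address, called a variable; slow and fast memory variables are disjoint sets. When a fast memory variable represents a copy of a slow memory variable $v$, then $v$ is called a cached slow memory variable. **Sequential execution.** A sequential execution $E=(e_1,\ldots,e_n)$ is a sequence of statements of the following types: Read, $read(v)$: allocates a location in fast memory and copies variable $v$ from slow to fast memory; Write, $write(v)$: copies $v$ from fast to slow memory and deallocates the location in fast memory; Compute, $compute(\{v_1,\ldots,v_k\})$: a statement accessing variables $v_1,\ldots,v_k$; Allocate, $allocate(v)$: introduces $v$ in fast memory; Free, $free(v)$: removes $v$ from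 fast memory. A Read or Allocate statement and a subsequent Write or Free statement are paired if the same variable $v$ is an operand of both and there are no intervening Reads, Allocates, Writes or Frees of $v$. A ''paired Allocate/Free'' is an Allocate statement and a Free statement that are paired. **Well formed.** An execution is well formed iff: operands of Reads (resp. Writes) are uncached (resp. cached) slow memory variables; operands of Allocates are uncached slow memory variables or fast memory variables; operands of Frees are cached slow memory variables or fast memory variables; every Read, Allocate, Write and Free statement is paired; and every Compute statement involving $v$ lies between paired Read/Allocate and Write/Free statements of $v$. **$M$-fit.** For a well-formed execution, the footprint after $e_i$ is $0$ for $i=0$ and for $i=n$; otherwise it increases by $1$ if $e_i$ is a Read or Allocate, is unchanged if $e_i$ is a Compute, and decreases by $1$ if $e_i$ is a Write or Free. The execution is $M$-fit if it is well formed and the footprint never exceeds $M$. **Legal.** A legal sequential execution of an instance of the geometric model is a sequential execution whose subsequence of Compute statements can be partitioned into contiguous chunks in one-to-one correspondence with $\mathcal{Z}$, such that all $m$ array variables $A_j(\phi_j(\mathcal{I}))$ appear as operands in the chunk corresponding to $\mathcal{I}$. **Asymptotics.** The asymptotic parameters are $M$ and $|\mathcal{Z}|$; the quantities $m$, $d$, $d_j$ and the coefficients of the $\phi_j$ are constants, on which the implied constant in $\Omega$ may depend (it may also depend on whether the arrays overlap). ''Sufficiently large $|\mathcal{Z}|$'' means $|\mathcal{Z}|=\omega(M^{s_{\mathrm{HBL}}})$. *)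

(* Defs.v *)
From HB Require Import structures.
From mathcomp Require Import all_boot all_order all_algebra finmap.
From mathcomp Require Import all_classical all_reals exp.

Set Implicit Arguments.
Unset Strict Implicit.
Unset Printing Implicit Defensive.

Import Order.TTheory GRing.Theory Num.Theory.
Local Open Scope classical_set_scope.
Local Open Scope ring_scope.

(** * Ranks of abelian groups *)

Definition Zindependent (V : zmodType) (B : {fset V}) : Prop :=
  forall c : V -> int, \sum_(v <- B) v *~ c v = 0 ->
  forall v, v \in B -> c v = 0.

Definition maximal_Zindependent (V : zmodType) (G : set V) (B : {fset V}) :
    Prop :=
  [/\ [set` B] `<=` G, Zindependent B
    & forall B' : {fset V}, [set` B'] `<=` G -> Zindependent B' ->
        [set` B] `<=` [set` B'] -> B' = B].

(** All maximal independent subsets of a group [G] have the same cardinality,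
    so that [xget] has no actual choice to make.  Independent subsets are taken
    finite, which is no restriction inside [Z^n]; the default value [0] would
    only be reached for groups of infinite rank. *)
Definition rank (V : zmodType) (G : set V) : nat :=
  xget 0%N [set r | exists2 B : {fset V}, maximal_Zindependent G B
                                        & #|` B|%fset = r].

(** * Z-affine maps, on row vectors *)

Record zaffine (p q : nat) := ZAffine {
  linear_part : 'M[int]_(p, q);
  translation : 'rV[int]_q }.

Definition zaffine_fun (p q : nat) (f : zaffine p q) (x : 'rV[int]_p) :
    'rV[int]_q :=
  x *m linear_part f + translation f.

Coercion zaffine_fun : zaffine >-> Funclass.

(** * The Hölder-Brascamp-Lieb linear program *)

Definition HBL_feasible (R : realType) (d m : nat) (dims : 'I_m -> nat)
    (phi : forall j : 'I_m, zaffine d (dims j)) (s : 'I_m -> R) : Prop :=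
  (forall j, 0 <= s j <= 1) /\
  forall H : zmodClosed 'rV[int]_d,
    (rank [set x | x \in H])%:R <=
    \sum_(j < m) s j *
      (rank [set x *m linear_part (phi j) | x in [set x | x \in H]])%:R.

Definition is_sHBL (R : realType) (d m : nat) (dims : 'I_m -> nat)
    (phi : forall j : 'I_m, zaffine d (dims j)) (sHBL : R) : Prop :=
  let values :=
    [set \sum_(j < m) s j | s in [set s : 'I_m -> R | HBL_feasible phi s]] in
  values sHBL /\ lbound values sHBL.

(** * Machine and sequential executions *)

(** Addresses: [inl] for slow memory, [inr] for fast memory. *)
Definition variable (slow fast : choiceType) : choiceType := (slow + fast)%type.

Inductive statement (V : choiceType) :=
| Read of V
| Write of V
| Compute of {fset V}
| Allocate of V
| Free of V.

Arguments Compute {V}.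

Definition execution (V : choiceType) := seq (statement V).

(** Statements are numbered from [0]: [onth E i] is the [(i+1)]-st one, and
    [take i E] consists of those preceding it. *)

Definition enters_at (V : choiceType) (E : execution V) (i : nat) (v : V) :
    Prop :=
  onth E i = Some (Read v) \/ onth E i = Some (Allocate v).

Definition leaves_at (V : choiceType) (E : execution V) (i : nat) (v : V) :
    Prop :=
  onth E i = Some (Write v) \/ onth E i = Some (Free v).

Definition paired (V : choiceType) (E : execution V) (i k : nat) (v : V) :
    Prop :=
  [/\ (i < k)%N, enters_at E i v, leaves_at E k v
    & forall l : nat, (i < l < k)%N -> ~ (enters_at E l v \/ leaves_at E l v)].

(** Whether [v] is present in fast memory once [E] has been run from an empty
    fast memory. *)
Definition resident (V : choiceType) (E : execution V) (v : V) : bool :=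
  foldl (fun b e => match e with
                    | Read w | Allocate w => (w == v) || b
                    | Write w | Free w => (w != v) && b
                    | Compute _ => b
                    end) false E.

Definition is_slow (slow fast : choiceType) (v : variable slow fast) : bool :=
  if v is inl _ then true else false.

Definition is_fast (slow fast : choiceType) (v : variable slow fast) : bool :=
  ~~ is_slow v.

Definition cached_slow (slow fast : choiceType)
    (E : execution (variable slow fast)) (v : variable slow fast) : bool :=
  is_slow v && resident E v.

Definition uncached_slow (slow fast : choiceType)
    (E : execution (variable slow fast)) (v : variable slow fast) : bool :=
  is_slow v && ~~ resident E v.

Record well_formed (slow fast : choiceType)
    (E : execution (variable slow fast)) : Prop := WellFormed {
  wf_read : forall i v, onth E i = Some (Read v) -> uncached_slow (take i E) v;
  wf_write : forall i v, onth E i = Some (Write v) -> cached_slow (take i E) v;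
  wf_allocate : forall i v, onth E i = Some (Allocate v) ->
    uncached_slow (take i E) v || is_fast v;
  wf_free : forall i v, onth E i = Some (Free v) ->
    cached_slow (take i E) v || is_fast v;
  wf_enter_paired : forall i v, enters_at E i v -> exists k, paired E i k v;
  wf_leave_paired : forall k v, leaves_at E k v -> exists i, paired E i k v;
  wf_compute : forall l (B : {fset variable slow fast}) v,
    onth E l = Some (Compute B) -> v \in B ->
    exists i k, paired E i k v /\ (i < l < k)%N }.

(** [footprint E i] is the footprint after the first [i] statements. *)
Fixpoint footprint (V : choiceType) (E : execution V) (i : nat) : int :=
  if i is i'.+1 then
    if i == size E then 0 else
    footprint E i' + match onth E i' with
                     | Some (Read _) | Some (Allocate _) => 1
                     | Some (Write _) | Some (Free _) => - 1
                     | Some (Compute _) | None => 0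
                     end
  else 0.

Definition M_fit (slow fast : choiceType) (M : nat)
    (E : execution (variable slow fast)) : Prop :=
  well_formed E /\ forall i, (i <= size E)%N -> footprint E i <= M%:Z.

Definition reads_writes (V : choiceType) (E : execution V) : nat :=
  count (fun e => match e with Read _ | Write _ => true | _ => false end) E.

(** * Executions of an instance of the geometric model *)

Definition compute_operands (V : choiceType) (E : execution V) :
    seq {fset V} :=
  pmap (fun e => if e is Compute B then Some B else None) E.

(** An element [(I, ch)] of [chunks] is an iteration [I] together with the
    chunk [ch] of consecutive Compute statements that corresponds to it.  Only
    the restriction of [A j] to the image of [phi j] is meaningful. *)
Definition legal (V : choiceType) (d m : nat) (dims : 'I_m -> nat)
    (phi : forall j : 'I_m, zaffine d (dims j)) (Z : {fset 'rV[int]_d})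
    (A : forall j : 'I_m, 'rV[int]_(dims j) -> V) (E : execution V) : Prop :=
  exists chunks : seq ('rV[int]_d * seq {fset V}),
    [/\ perm_eq (unzip1 chunks) Z,
        flatten (unzip2 chunks) = compute_operands E
      & forall I ch, (I, ch) \in chunks -> forall j : 'I_m,
          exists2 B : {fset V}, B \in ch & A j (phi j I) \in B].

Definition array_variable (V : choiceType) (d m : nat) (dims : 'I_m -> nat)
    (phi : forall j : 'I_m, zaffine d (dims j)) (Z : {fset 'rV[int]_d})
    (A : forall j : 'I_m, 'rV[int]_(dims j) -> V) (v : V) : Prop :=
  exists I (j : 'I_m), I \in Z /\ v = A j (phi j I).

Definition no_paired_Allocate_Free (V : choiceType) (P : V -> Prop)
    (E : execution V) : Prop :=
  forall i k v, P v -> paired E i k v ->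
    ~ (onth E i = Some (Allocate v) /\ onth E k = Some (Free v)).

(* Main.v *)
From HB Require Import structures.
Require Import Defs.
From mathcomp Require Import all_boot all_order all_algebra finmap.
From mathcomp Require Import all_classical all_reals exp.
From mathcomp Require Import topology normedtype derive.
From mathcomp Require Import zify ring lra.

(** The discrete Hölder-Brascamp-Lieb inequality is proved in entropy form: for
    [X] uniform on a finite set, [Ent X <= \sum_j s_j Ent (phi_j X)].  The right
    side is affine in [s], so as long as two of the [s_j] are positive one can
    trade one for the other in a direction that does not increase it, keeping
    the constraint at the full space unchanged, until either some [s_j] vanishes
    or a proper nonzero subspace [V] becomes tight; in the latter case the chain
    rule splits the inequality into its analogues on [V] and on the quotient by
    [V].  If a single [s_j] remains, [phi_j] is injective and [s_j >= 1].

    Cut the execution into segments of [M] reads and writes.  The operands of a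
    segment that are array variables number at most [3 M], so at most
    [(3 M)^sHBL] iterations run inside one segment, and at most one iteration is
    cut by each segment boundary. *)

Set Implicit Arguments.
Unset Strict Implicit.
Unset Printing Implicit Defensive.

Import Order.TTheory GRing.Theory Num.Theory.
Import numFieldNormedType.Exports.
Local Open Scope classical_set_scope.
Local Open Scope ring_scope.

(** * Entropy of a function on a finite set *)

Definition fiber (T : finType) (W : eqType) (A : {set T}) (f : T -> W) (t : T) :
    {set T} := [set u in A | f u == f t].

(** This is [#|A|] times the Shannon entropy of [f X] for [X] uniform on [A]. With this scaling the
    conditional entropies in the chain rule add up without weights. *)
Definition entropy (R : realType) (T : finType) (W : eqType) (A : {set T})
    (f : T -> W) : R :=
  \sum_(t in A) (ln #|A|%:R - ln #|fiber A f t|%:R).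

Section Entropy.
Variables (R : realType) (T : finType).
Implicit Types (A B : {set T}).

Lemma fiber_self (W : eqType) A (f : T -> W) t : t \in A -> t \in fiber A f t.
Proof. by rewrite inE eqxx andbT. Qed.

Lemma card_fiber_gt0 (W : eqType) A (f : T -> W) t :
  t \in A -> (0 < #|fiber A f t|)%N.
Proof. by move=> tA; apply/card_gt0P; exists t; exact: fiber_self. Qed.

Lemma card_fiber_gt0R (W : eqType) A (f : T -> W) t :
  t \in A -> 0 < #|fiber A f t|%:R :> R.
Proof. by move=> tA; rewrite ltr0n card_fiber_gt0. Qed.

Lemma mem_fiber_eq (W : eqType) A (f : T -> W) t u :
  u \in fiber A f t -> fiber A f u = fiber A f t.
Proof.
by rewrite inE => /andP[_ /eqP ut]; apply/setP => v; rewrite !inE ut.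
Qed.

Lemma eq_entropy (W W' : eqType) A (f : T -> W) (g : T -> W') :
  {in A &, forall t u, (f t == f u) = (g t == g u)} ->
  entropy R A f = entropy R A g.
Proof.
move=> fg; apply: eq_bigr => t tA; congr (_ - ln _%:R).
by apply: eq_card => u; rewrite !inE; case uA: (u \in A) => //=; exact: fg.
Qed.

Lemma entropy_ge0 (W : eqType) A (f : T -> W) : 0 <= entropy R A f.
Proof.
apply: sumr_ge0 => t tA; rewrite subr_ge0.
rewrite ler_ln ?posrE ?card_fiber_gt0R// ?ler_nat ?ltr0n.
  by apply: subset_leq_card; apply/fintype.subsetP => u; rewrite inE => /andP[].
by apply/card_gt0P; exists t.
Qed.

Lemma entropy_inj (W : eqType) A (f : T -> W) : {in A &, injective f} ->
  entropy R A f = #|A|%:R * ln #|A|%:R.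
Proof.
move=> finj; rewrite /entropy (eq_bigr (fun=> ln #|A|%:R)).
  by rewrite sumr_const mulr_natl.
move=> t tA; rewrite (_ : fiber A f t = [set t]%SET) ?cards1 ?ln1 ?subr0//.
apply/setP => u; rewrite !inE; apply/andP/eqP => [[uA /eqP/finj]|->]; last by [].
exact.
Qed.

Lemma ln_le_tangent (x c : R) : 0 < x -> 0 < c -> ln x <= ln c + (x / c - 1).
Proof.
move=> x0 c0; rewrite -lerBlDl -ln_div ?posrE//.
have xc0 : 0 < x / c by rewrite divr_gt0.
by rewrite -{1}[x / c](subrKC 1) le_ln1Dx//; lra.
Qed.

Lemma card_fiberE (W : eqType) A (f : T -> W) t :
  #|fiber A f t|%:R = \sum_(u in A) (f u == f t)%:R :> R.
Proof.
rewrite -natr_sum -big_mkcondr sum1_card; congr (_%:R).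
by apply: eq_card => u; rewrite !inE.
Qed.

(** A nonempty level set with [k] elements contributes [k] terms [1 / k], an empty one contributes
    nothing. *)
Lemma sum_inv_fiber_le1 (W : eqType) A (f : T -> W) w :
  \sum_(t in A) (f t == w)%:R / #|fiber A f t|%:R <= 1 :> R.
Proof.
have [t0 /andP[t0A /eqP <-]|nofiber] := pickP [pred t in A | f t == w];
  last first.
  rewrite big1 ?ler01// => t tA.
  by move: (nofiber t); rewrite !inE tA/= => ->; rewrite mul0r.
rewrite (eq_bigr (fun t => (f t == f t0)%:R / #|fiber A f t0|%:R)).
  rewrite -mulr_suml -card_fiberE divff//.
  by rewrite gt_eqF// card_fiber_gt0R.
move=> t tA; have [ft|] := eqVneq; last by rewrite !mul0r.
by rewrite (@mem_fiber_eq _ _ _ t0)// inE tA ft/=.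
Qed.

(** The tangent to [ln] at [#|F|] bounds each [ln (#|A| / #|fiber|)]. The reciprocals of the fiber
    sizes sum to at most [#|F|], so the linear corrections have a nonpositive total. *)
Lemma entropy_le_card (W : choiceType) A (f : T -> W) (F : {fset W}) :
  (forall t, t \in A -> f t \in F) ->
  entropy R A f <= #|A|%:R * ln #|` F|%:R.
Proof.
move=> fF.
have [->|[t0 t0A]] := set_0Vmem A.
  by rewrite /entropy big_set0 cards0 mul0r.
have A0 : 0 < #|A|%:R :> R by rewrite ltr0n; apply/card_gt0P; exists t0.
have F0 : 0 < #|` F|%:R :> R.
  by rewrite ltr0n cardfs_gt0; apply/fset0Pn; exists (f t0); exact: fF.
have inv_sum : \sum_(t in A) (#|fiber A f t|%:R)^-1 <= #|` F|%:R :> R.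
  rewrite (eq_bigr (fun t => \sum_(w <- F) (f t == w)%:R / #|fiber A f t|%:R)).
    rewrite exchange_big/= card_fset_sum1 natr_sum.
    by apply: ler_sum => w _; exact: sum_inv_fiber_le1.
  move=> t tA; rewrite (big_rem (f t)) ?fF//= eqxx mul1r big_seq big1 ?addr0//.
  move=> w; rewrite mem_rem_uniq ?fset_uniq// inE => /andP[/negbTE wf _].
  by rewrite eq_sym wf mul0r.
apply: (@le_trans _ _ (\sum_(t in A)
    (ln #|` F|%:R - 1 + #|A|%:R / #|` F|%:R * (#|fiber A f t|%:R)^-1))).
  apply: ler_sum => t tA; have N0 := card_fiber_gt0R f tA.
  rewrite -ln_div ?posrE//.
  apply: le_trans (@ln_le_tangent _ #|` F|%:R _ _) _ => //.
    by rewrite divr_gt0.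
  by rewrite [X in _ <= _ + X]mulrAC; lra.
rewrite big_split/= sumr_const -[X in X + _]mulr_natl -mulr_sumr mulrBr mulr1.
rewrite -addrA gerDl addrC subr_le0.
by rewrite mulrAC ler_pdivrMr// ler_wpM2l// ltW.
Qed.

Lemma sum_fibers (W : eqType) A (f : T -> W) (G : {set T} -> T -> R) :
  \sum_(B in [set fiber A f t | t in A]%SET) \sum_(t in B) G B t =
  \sum_(t in A) G (fiber A f t) t.
Proof.
rewrite [RHS](partition_big_imset (fiber A f)); apply: eq_bigr => B.
move=> /imsetP[t0 t0A ->]; apply: eq_big => t; last first.
  by move=> /mem_fiber_eq ->.
apply/idP/andP => [tt0|[tA /eqP <-]]; last exact: fiber_self.
rewrite (mem_fiber_eq tt0) eqxx; split=> //.
by move: tt0; rewrite inE => /andP[].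
Qed.

(** Since [x] determines [p], a fiber of [x] lies inside a single fiber of [p], and the logarithms
    of the sizes of the [p]-fibers cancel. *)
Lemma entropy_chain (W U : eqType) A (x : T -> W) (p : T -> U) :
  {in A &, forall t u, x t = x u -> p t = p u} ->
  entropy R A x = entropy R A p +
    \sum_(B in [set fiber A p t | t in A]%SET) entropy R B x.
Proof.
move=> xp; rewrite sum_fibers -big_split; apply: eq_bigr => t tA /=.
rewrite addrA subrK; congr (_ - ln _%:R); apply: eq_card => u; rewrite !inE.
case uA: (u \in A) => //=; case: eqP => [/xp pe|_]; last by rewrite andbF.
by rewrite pe ?eqxx.
Qed.

(* Conditioning [y] on [w] leaves at most the entropy that conditioning it on the
   common factor [z] of [y] and [w] leaves; after [ln r <= r - 1] this is a
   double count of pairs. *)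
Lemma entropy_condition (W U Y : eqType) A (w : T -> U) (y : T -> W)
    (z : T -> Y) :
  {in A &, forall t u, w t = w u -> z t = z u} ->
  {in A &, forall t u, y t = y u -> z t = z u} ->
  entropy R A z + \sum_(B in [set fiber A w t | t in A]%SET) entropy R B y <=
  entropy R A y.
Proof.
move=> wz yz; rewrite sum_fibers -big_split -subr_le0 /entropy -sumrB /=.
pose p t := (w t, y t).
have pE t : fiber (fiber A w t) y t = fiber A p t.
  by apply/setP => u; rewrite !inE xpair_eqE andbA.
(* The sizes of the [w]- and [y]-fibers of [t] are expanded into sums over [a] and [b], and the sum
   over [t] is then carried out first. *)
have key : \sum_(t in A) (#|fiber A w t|%:R * #|fiber A y t|%:R /
    (#|fiber A z t|%:R * #|fiber A p t|%:R)) <= #|A|%:R :> R.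
  under eq_bigr => t tA.
    rewrite !card_fiberE big_distrl/= big_distrl/=.
    under eq_bigr => a aA do rewrite big_distrr/= big_distrl/=.
    over.
  rewrite exchange_big/=.
  under eq_bigr do rewrite exchange_big/=.
  rewrite -sum1_card natr_sum; apply: ler_sum => a aA.
  rewrite [leRHS](_ : _ = \sum_(b in A) (z b == z a)%:R / #|fiber A z a|%:R);
    last first.
    by rewrite -mulr_suml -card_fiberE divff// gt_eqF// card_fiber_gt0R.
  (* For fixed [a] and [b], the [t] that contribute form the [p]-fiber over [(w a, y b)], and on it
     [z a = z t = z b]. *)
  apply: ler_sum => b bA.
  rewrite -[leRHS]mulr1.
  apply: le_trans (ler_wpM2l _ (sum_inv_fiber_le1 A p (w a, y b))); last first.
    by rewrite divr_ge0.
  rewrite big_distrr/=; apply: ler_sum => t tA.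
  rewrite -!card_fiberE xpair_eqE (eq_sym (w t)) (eq_sym (y t)).
  have [wat|] := eqVneq (w a) (w t); last by rewrite !(mul0r, mulr0).
  have [ybt|] := eqVneq (y b) (y t); last by rewrite !(mul0r, mulr0).
  have za := wz _ _ aA tA wat; have zb := yz _ _ bA tA ybt.
  have -> : fiber A z a = fiber A z t by apply: mem_fiber_eq; rewrite inE aA za/=.
  by rewrite za zb eqxx/= !mul1r invfM.
apply: (@le_trans _ _ (\sum_(t in A) (#|fiber A w t|%:R * #|fiber A y t|%:R /
    (#|fiber A z t|%:R * #|fiber A p t|%:R) - 1))).
  apply: ler_sum => t tA; rewrite pE.
  have Nw := card_fiber_gt0R w tA; have Ny := card_fiber_gt0R y tA.
  have Nz := card_fiber_gt0R z tA; have Np := card_fiber_gt0R p tA.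
  have := @ln_le_tangent (#|fiber A w t|%:R * #|fiber A y t|%:R /
    (#|fiber A z t|%:R * #|fiber A p t|%:R)) 1 _ ltr01.
  rewrite ln1 divr1 add0r divr_gt0 ?mulr_gt0//.
  move=> /(_ isT).
  rewrite ln_div ?posrE ?mulr_gt0// !lnM ?posrE//; lra.
by rewrite sumrB sumr_const subr_le0.
Qed.

End Entropy.

(** * The Hölder-Brascamp-Lieb inequality over a field *)

(** Rank-nullity for the quotient map [cokermx V], whose kernel is the row space of [V], restricted
    to the sum of the two row spaces. *)
Lemma mxrank_col_coker (F : fieldType) (p q n : nat) (V : 'M[F]_(p, n))
    (W : 'M[F]_(q, n)) :
  \rank (col_mx V W) = (\rank V + \rank (W *m cokermx V))%N.
Proof.
rewrite -(mxrank_mul_ker (col_mx V W) (cokermx V)) mul_col_mx mulmx_coker.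
have VW : (V <= col_mx V W)%MS by rewrite -addsmxE addsmxSl.
have kerV : (kermx (cokermx V) == V)%MS.
  by apply/andP; split; [rewrite submxE mulmx_ker|apply/sub_kermxP/mulmx_coker].
have -> : \rank (col_mx V W :&: kermx (cokermx V)) = \rank V.
  by rewrite (cap_eqmx (eqmx_refl _) (eqmxP kerV)) (capmx_idPr VW).
rewrite addnC; by rewrite rank_col_0mx.
Qed.

(** The step is the least ratio [D k / b k] over the constraints that [t0] would violate, or [t0]
    itself if there are none; [K] is finite, so the minimum is attained. *)
Lemma first_tight (R : realFieldType) (K : finType) (P : pred K) (D b : K -> R)
    (t0 : R) :
  (forall k, P k -> 0 <= D k) -> 0 <= t0 ->
  exists t, [/\ 0 <= t <= t0, forall k, P k -> t * b k <= D k
    & t = t0 \/ exists k, [/\ P k, 0 < b k & t * b k = D k]].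
Proof.
move=> D0 t00; pose Q k := [&& P k, 0 < b k & D k < t0 * b k].
have [k0 Qk0|noQ] := pickP Q; last first.
  exists t0; split; [by rewrite t00 lexx| |by left].
  move=> k Pk; move: (noQ k); rewrite /Q Pk/=.
  have [b0 /= /negbT|b0 _] := ltP 0 (b k); first by rewrite -leNgt.
  exact: le_trans (mulr_ge0_le0 t00 b0) (D0 _ Pk).
case: (arg_minP (fun k => D k / b k) Qk0) => k1 /and3P[Pk1 b1 Dk1] min1.
have t1 : D k1 / b k1 < t0 by rewrite ltr_pdivrMr.
have t1_ge0 : 0 <= D k1 / b k1 by rewrite divr_ge0 ?D0// ltW.
exists (D k1 / b k1); split.
- by rewrite t1_ge0 ltW.
- move=> k Pk; have [bk|bk] := ltP 0 (b k); last first.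
    exact: le_trans (mulr_ge0_le0 t1_ge0 bk) (D0 _ Pk).
  have [Dk|Dk] := ltP (D k) (t0 * b k); last first.
    by apply: le_trans Dk; rewrite ler_wpM2r// ltW.
  by rewrite -ler_pdivlMr// min1// /Q Pk bk.
- by right; exists k1; split=> //; rewrite divfK ?gt_eqF.
Qed.

Section HBLEntropy.
Variables (R : realType) (F : fieldType) (T : finType) (m : nat).

(** Exponents may exceed 1 here, because trading one exponent for another can raise it past 1.
    Square matrices suffice to represent every subspace as a row space. *)
Definition rank_feasible n (dims : 'I_m -> nat)
    (Phi : forall j, 'M[F]_(n, dims j)) (s : 'I_m -> R) : Prop :=
  (forall j, 0 <= s j) /\
  forall V : 'M[F]_n, (\rank V)%:R <= \sum_j s j * (\rank (V *m Phi j))%:R.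

Definition entropic n : Prop :=
  forall (dims : 'I_m -> nat) (Phi : forall j, 'M[F]_(n, dims j)) s,
    rank_feasible Phi s -> forall (A : {set T}) (x : T -> 'rV[F]_n),
    entropy R A x <= \sum_j s j * entropy R A (fun t => x t *m Phi j).

Lemma rank_feasible_rect n (dims : 'I_m -> nat)
    (Phi : forall j, 'M[F]_(n, dims j)) (s : 'I_m -> R) p (V : 'M[F]_(p, n)) :
  rank_feasible Phi s ->
  (\rank V)%:R <= \sum_j s j * (\rank (V *m Phi j))%:R.
Proof.
move=> [_ /(_ <<V>>%MS)]; rewrite mxrank_gen => /le_trans; apply.
by apply: ler_sum => j _; rewrite (eqmxMr _ (genmxE V)).
Qed.

Lemma entropic_split n (V : 'M[F]_n) (dims : 'I_m -> nat)
    (Phi : forall j, 'M[F]_(n, dims j)) s :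
  rank_feasible Phi s ->
  (\rank V)%:R = \sum_j s j * (\rank (V *m Phi j))%:R ->
  entropic (\rank V) -> entropic (\rank (cokermx V)) ->
  forall (A : {set T}) (x : T -> 'rV[F]_n),
    entropy R A x <= \sum_j s j * entropy R A (fun t => x t *m Phi j).
Proof.
move=> feas crit entV entQ A x; have s0 := feas.1.
(* [C] sends a vector to coordinates on the quotient by [V], and [C'] is a section of it. *)
pose C := col_base (cokermx V).
have [C' C'C] : exists C', C' *m C = 1%:M.
  by exists (pinvmx C); rewrite mulVpmx// col_base_full.
have mulK q (Y : 'M_(q, n)) : Y *m cokermx V = Y *m C *m row_base (cokermx V).
  by rewrite -mulmxA mulmx_base.
(* [Psi j] is the map that [Phi j] induces from the quotient by [V] to the quotient by
   [V *m Phi j]. *)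
pose D j := cokermx (V *m Phi j).
pose Psi j := C' *m Phi j *m D j.
have CPsi j : C *m Psi j = Phi j *m D j.
  rewrite /Psi -(mulmxA C') (mulmxA C C') -[RHS]mul1mx; apply/eqP.
  rewrite -subr_eq0 -mulmxBl; apply/eqP.
  have : (C *m C' - 1%:M <= V)%MS.
    by rewrite submxE mulK mulmxBl -(mulmxA C) C'C mulmx1 mul1mx subrr mul0mx.
  by case/submxP => Y ->; rewrite -(mulmxA Y) (mulmxA V) mulmx_coker mulmx0.
pose p t := x t *m C.
(* The constraint at the preimage of [W] in the full space, minus the tight constraint at [V], is
   the constraint at [W] in the quotient. *)
have feasQ : rank_feasible Psi s.
  split=> // W; have := rank_feasible_rect (col_mx V (W *m C')) feas.
  rewrite mxrank_col_coker natrD crit.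
  have -> : \rank (W *m C' *m cokermx V) = \rank W.
    by rewrite mulK -(mulmxA W) C'C mulmx1 mxrankMfree// row_base_free.
  under [leRHS]eq_bigr => j _ do
    rewrite mul_col_mx mxrank_col_coker natrD mulrDr -!mulmxA (mulmxA C').
  by rewrite big_split/= lerD2l.
have feasV : rank_feasible (fun j => row_base V *m Phi j) s.
  split=> // W; have := rank_feasible_rect (W *m row_base V) feas.
  rewrite mxrankMfree ?row_base_free//.
  by under eq_bigr do rewrite -mulmxA.
(* On a fiber of [p], [x] stays in one coset of [V]; subtracting [x t0] moves it into [V] and
   changes none of the entropies. *)
have entB B : B \in [set fiber A p t | t in A]%SET ->
    entropy R B x <= \sum_j s j * entropy R B (fun t => x t *m Phi j).
  case/imsetP => t0 t0A ->; set B0 := fiber _ _ _.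
  pose y t := (x t - x t0) *m pinvmx (row_base V).
  have yE t : t \in B0 -> y t *m row_base V = x t - x t0.
    rewrite inE => /andP[tA /eqP pt]; rewrite mulmxKpV// eq_row_base.
    by rewrite submxE mulK mulmxBl -/(p t) pt subrr mul0mx.
  have -> : entropy R B0 x = entropy R B0 y.
    apply: eq_entropy => t u tB uB; apply/eqP/eqP => [e|e]; first by rewrite /y e.
    by apply: (addIr (- x t0)); rewrite -!yE// e.
  apply: le_trans (entV _ _ _ feasV B0 y) _; apply: ler_sum => j _.
  rewrite ler_wpM2l// le_eqVlt; apply/orP; left; apply/eqP.
  apply: eq_entropy => t u tB uB.
  rewrite (mulmxA (y t)) (mulmxA (y u)) !yE// !mulmxBl.
  by apply/eqP/eqP => [/addIr//|->].
rewrite (@entropy_chain R T _ _ A x p); last by move=> t u _ _; rewrite /p => ->.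
apply: (@le_trans _ _ (\sum_j s j * entropy R A (fun t => p t *m Psi j) +
    \sum_(B in [set fiber A p t | t in A]%SET)
      \sum_j s j * entropy R B (fun t => x t *m Phi j))).
  by apply: lerD; [exact: entQ|exact: ler_sum].
rewrite exchange_big/= -big_split/=; apply: ler_sum => j _.
(* The common factor is [p t *m Psi j]: it is a function of [p t], and also of [x t *m Phi j]. *)
rewrite -mulr_sumr -mulrDr ler_wpM2l//; apply: entropy_condition => t u _ _.
  by move=> ->.
by rewrite /p -!(mulmxA _ C) CPsi !(mulmxA _ (Phi j)) => ->.
Qed.

(* Move along [s i += t * rank (Phi j), s j -= t * rank (Phi i)]: the hypothesis
   on [L] says that the right side does not increase, and every [V] of rank [0]
   or [n] has a constraint unaffected by the move, so a constraint that stops it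
   belongs to a proper nonzero [V]. *)
Lemma entropic_shrink n (dims : 'I_m -> nat) (Phi : forall j, 'M[F]_(n, dims j))
    (s : 'I_m -> R) (i j : 'I_m) (A : {set T}) (x : T -> 'rV[F]_n) :
  let L k := entropy R A (fun t => x t *m Phi k) in
  rank_feasible Phi s -> i != j -> 0 < s i -> 0 < s j ->
  (0 < \rank (Phi i))%N -> (0 < \rank (Phi j))%N ->
  L i * (\rank (Phi j))%:R <= L j * (\rank (Phi i))%:R ->
  exists s' : 'I_m -> R, [/\ rank_feasible Phi s',
    \sum_k s' k * L k <= \sum_k s k * L k &
    (s' j = 0 /\ forall k, s k = 0 -> s' k = 0) \/
    exists2 V : 'M[F]_n, (0 < \rank V < n)%N &
      (\rank V)%:R = \sum_k s' k * (\rank (V *m Phi k))%:R].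
Proof.
move=> L feas ij si sj ri rj Lij; have s0 := feas.1.
set Ri : R := (\rank (Phi i))%:R; set Rj : R := (\rank (Phi j))%:R.
have Ri0 : 0 < Ri by rewrite ltr0n.
have Rj0 : 0 < Rj by rewrite ltr0n.
pose step t k := s k + t * ((k == i)%:R * Rj - (k == j)%:R * Ri).
have sum_step t (G : 'I_m -> R) : \sum_k step t k * G k =
    \sum_k s k * G k - t * (Ri * G j - Rj * G i).
  under eq_bigr do rewrite mulrDl.
  rewrite big_split/=; congr (_ + _).
  rewrite (bigD1 i)//= (bigD1 j) 1?eq_sym//=.
  rewrite big1 => [|k /andP[/negbTE ki /negbTE kj]].
    by rewrite !eqxx (eq_sym j) (negbTE ij) /=; ring.
  by rewrite ki kj /=; ring.
(* A constraint depends on [V] only through its ranks. These take finitely many values, so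
   [first_tight] applies even over an infinite field. *)
pose K := ('I_n.+1 * {ffun 'I_m -> 'I_n.+1})%type.
pose ranks (V : 'M[F]_n) : K :=
  (inord (\rank V), [ffun k => inord (\rank (V *m Phi k))]).
have ranks1 V : (ranks V).1 = \rank V :> nat.
  by rewrite /= inordK// ltnS rank_leq_row.
have ranks2 V k : (ranks V).2 k = \rank (V *m Phi k) :> nat.
  by rewrite /= ffunE inordK// ltnS rank_leq_row.
pose P (r : K) := `[< exists V, ranks V = r >].
pose slack (r : K) : R := \sum_k s k * (r.2 k : nat)%:R - (r.1 : nat)%:R.
pose b (r : K) : R := Ri * (r.2 j : nat)%:R - Rj * (r.2 i : nat)%:R.
have slack0 r : P r -> 0 <= slack r.
  move=> /asboolP[V <-]; rewrite /slack ranks1 subr_ge0.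
  apply: le_trans (feas.2 V) _; apply: ler_sum => k _.
  by rewrite ranks2.
(* At [t = s j / Ri] the exponent of [j] reaches 0. *)
have t00 : 0 <= s j / Ri by rewrite divr_ge0 ?ltW.
have [t [/andP[t_ge0 t_le] tb tight]] := first_tight b slack0 t00.
have Pr V : P (ranks V) by apply/asboolP; exists V.
exists (step t); split.
- split=> [k|V].
    rewrite /step; have [->|ki] := eqVneq k i.
      by rewrite (negbTE ij) mul0r subr0 mul1r addr_ge0// mulr_ge0// ltW.
    have [->|kj] := eqVneq k j; last by rewrite !mul0r subrr mulr0 addr0.
    by rewrite mul0r sub0r mul1r mulrN subr_ge0 -ler_pdivlMr.
  have := tb _ (Pr V); rewrite sum_step /slack /b ranks1 !ranks2.
  under eq_bigr do rewrite ranks2.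
  lra.
- rewrite sum_step gerBl mulr_ge0// subr_ge0.
  by rewrite mulrC [leRHS]mulrC.
- case: tight => [->|[r [/asboolP[V <-] b0 tight]]].
    left; split=> [|k sk].
      by rewrite /step eqxx eq_sym (negbTE ij) mul0r mul1r sub0r mulrN
        divfK ?subrr ?gt_eqF.
    have ki : k != i by apply: contraTneq si => <-; rewrite sk ltxx.
    have kj : k != j by apply: contraTneq sj => <-; rewrite sk ltxx.
    by rewrite /step sk (negbTE ki) (negbTE kj) !mul0r subrr mulr0 addr0.
  right; exists V; last first.
    move: tight; rewrite sum_step /slack /b ranks1 !ranks2.
    under eq_bigr do rewrite ranks2.
    lra.
  move: b0; rewrite /b !ranks2 => b0; rewrite lt0n ltn_neqAle rank_leq_row andbT.
  apply/andP; split; apply: contraTneq b0 => rV; rewrite -leNgt.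
    have := rank_leq_row V.
    have z k : \rank (V *m Phi k) = 0%N.
      by apply/eqP; rewrite -leqn0 -rV mxrankM_maxl.
    by rewrite !z !mulr0 subrr.
  have fullV : row_full V by rewrite /row_full rV.
  by rewrite !(eqmxMfull _ fullV) -/Ri -/Rj mulrC subrr.
Qed.

Lemma entropy_dim0 n (A : {set T}) (x : T -> 'rV[F]_n) :
  n = 0%N -> entropy R A x = 0.
Proof.
move=> n0; rewrite /entropy big1// => t tA.
rewrite (_ : fiber A x t = A) ?subrr//.
apply/setP => u; rewrite !inE; subst n.
by rewrite (thinmx0 (x u)) (thinmx0 (x t)) eqxx andbT.
Qed.

(** Induction on [n], and for fixed [n] on the number of nonzero exponents: a trade either shrinks
    the support or yields a tight [V] for which [V] and the quotient both have dimension below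
    [n]. *)
Theorem entropy_HBL n : entropic n.
Proof.
elim/ltn_ind: n => n IHn dims Phi s.
move: {2}#|_| (leqnn #|[pred j | s j != 0]|) => N.
elim: N s => [|N IHN] s.
  rewrite leqn0 => /eqP/card0_eq sE [s0 feas] A x.
  have sz j : s j = 0 by move: (sE j); rewrite !inE => /negbFE/eqP.
  have := feas 1%:M; rewrite mxrank1 big1 => [|j _]; last by rewrite sz mul0r.
  rewrite lern0 => /eqP n0; rewrite big1 => [|j _]; last by rewrite sz mul0r.
  by rewrite entropy_dim0.
move=> suppN feas A x; have s0 := feas.1.
pose L j := entropy R A (fun t => x t *m Phi j).
have L0 j : 0 <= L j by exact: entropy_ge0.
have supp_shrink (s' : 'I_m -> R) j : s j != 0 -> s' j = 0 ->
    (forall k, s k = 0 -> s' k = 0) -> (#|[pred k | s' k != 0%R]| <= N)%N.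
  move=> sj sj' sub; rewrite -ltnS; apply: leq_trans suppN.
  apply: proper_card; apply/properP; split.
    by apply/fintype.subsetP => k; rewrite !inE; apply: contraNN => /eqP/sub ->.
  by exists j; rewrite !inE// sj' eqxx.
have [i si|noS] := pickP [pred j | s j != 0]; last first.
  by apply: IHN => //; rewrite (eq_card (B := pred0)) ?card0.
have [j /= /andP[ij sj]|onlyi] := pickP [pred j | (i != j) && (s j != 0)];
  last first.
  have sz j : i != j -> s j = 0.
    by move=> ij; move: (onlyi j); rewrite /= ij => /negbFE/eqP.
  have sumE G : \sum_j s j * G j = s i * G i.
    rewrite (bigD1 i)//= big1 ?addr0// => j ji.
    by rewrite sz ?mul0r// eq_sym.
  (* The constraint at the kernel of [Phi i] has right side 0. *)
  have freei : row_free (Phi i).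
    rewrite -kermx_eq0 -mxrank_eq0 -(lern0 R).
    apply: le_trans (feas.2 _) _; rewrite sumE.
    by rewrite mulmx_ker mxrank0 mulr0.
  have [n0|n_gt0] := posnP n.
    apply: (@le_trans _ _ 0); last first.
      by apply: sumr_ge0 => j _; rewrite mulr_ge0 ?entropy_ge0.
    by rewrite entropy_dim0.
  have si1 : 1 <= s i.
    have := feas.2 1%:M; rewrite sumE mxrank1 mul1mx (eqP freei).
    by rewrite ler_pMl// ltr0n.
  rewrite sumE; apply: (@le_trans _ _ (L i)); last by rewrite ler_peMl.
  rewrite le_eqVlt; apply/orP; left; apply/eqP; apply: eq_entropy => t u _ _.
  apply/eqP/eqP => [->//|]; exact: row_free_inj.
(* A zero map contributes to no constraint, so its exponent can be set to 0; afterwards both maps in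
   the trade have positive rank. *)
have drop k : s k != 0 -> \rank (Phi k) = 0%N ->
    entropy R A x <= \sum_j s j * entropy R A (fun t => x t *m Phi j).
  move=> sk rk; pose s' l := if l == k then 0 else s l.
  have s'le l : 0 <= s' l <= s l by rewrite /s'; case: eqP; rewrite ?lexx s0.
  apply: (@le_trans _ _ (\sum_j s' j * L j)).
    apply: IHN.
      apply: (supp_shrink _ k) => //; first by rewrite /s' eqxx.
      by move=> l sl; rewrite /s' sl; case: ifP.
    split=> [l|V]; first by case/andP: (s'le l).
    apply: le_trans (feas.2 V) _; rewrite le_eqVlt; apply/orP; left.
    apply/eqP/eq_bigr => l _; rewrite /s'; case: eqP => // ->.
    have /eqP -> : \rank (V *m Phi k) == 0%N by rewrite -leqn0 -rk mxrankM_maxr.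
    by rewrite !mulr0.
  by apply: ler_sum => l _; rewrite ler_wpM2r// (andP (s'le l)).2.
have gt0 k : s k != 0 -> 0 < s k by rewrite lt_def s0 => ->.
have [/eqP|ri] := posnP (\rank (Phi i)); first by move/eqP/drop; exact.
have [/eqP|rj] := posnP (\rank (Phi j)); first by move/eqP/drop; exact.
have [s' [feas' le_s' crit]] : exists s' : 'I_m -> R, [/\ rank_feasible Phi s',
    \sum_k s' k * L k <= \sum_k s k * L k &
    (exists2 l, s l != 0 & s' l = 0 /\ forall k, s k = 0 -> s' k = 0) \/
    exists2 V : 'M[F]_n, (0 < \rank V < n)%N &
      (\rank V)%:R = \sum_k s' k * (\rank (V *m Phi k))%:R].
  (* Of the two opposite trades between [i] and [j], at least one does not increase the right
     side. *)
  have [le_ij|/ltW le_ji] :=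
      leP (L i * (\rank (Phi j))%:R) (L j * (\rank (Phi i))%:R).
    have [s' [? ? H]] :=
      entropic_shrink feas ij (gt0 _ si) (gt0 _ sj) ri rj le_ij.
    by exists s'; split=> //; case: H; [left; exists j|right].
  have ji : j != i by rewrite eq_sym.
  have [s' [? ? H]] :=
    entropic_shrink feas ji (gt0 _ sj) (gt0 _ si) rj ri le_ji.
  by exists s'; split=> //; case: H; [left; exists i|right].
apply: le_trans le_s'; case: crit => [[l sl [sl' sub]]|[V /andP[V0 Vn] crit]].
  by apply: IHN => //; exact: (supp_shrink _ l).
apply: (entropic_split feas' crit (IHn _ Vn) (IHn _ _)).
by rewrite mxrank_coker ltn_subrL V0 (leq_trans V0)// ltnW.
Qed.

End HBLEntropy.

(** * Ranks of subgroups of Z^n as dimensions over Q *)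

Notation ratmx := (map_mx (intr : int -> rat)).

Lemma ratmx_inj (p q : nat) :
  injective (ratmx : 'M[int]_(p, q) -> 'M[rat]_(p, q)).
Proof.
move=> x y /matrixP xy; apply/matrixP => i j.
by have := xy i j; rewrite !mxE => /eqP; rewrite eqr_int => /eqP.
Qed.

Lemma ratmxMz (p q : nat) (x : 'M[int]_(p, q)) (k : int) :
  ratmx (x *~ k) = k%:~R *: ratmx x.
Proof. by rewrite raddfMz scaler_int. Qed.

Lemma clear_denominators (n : nat) (v : 'rV[rat]_n) :
  exists D : int, D != 0 /\ exists w : 'rV[int]_n, ratmx w = D%:~R *: v.
Proof.
exists (\prod_i denq (v 0 i)); split.
  by apply/prodf_neq0 => i _; exact: denq_neq0.
exists (\row_i (numq (v 0 i) * \prod_(k | k != i) denq (v 0 k))).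
apply/rowP => i; rewrite !mxE [in RHS](bigD1 i)//= !intrM numqE; ring.
Qed.

Section Rank.
Variable n : nat.
Implicit Types (B : {fset 'rV[int]_n}) (G : set 'rV[int]_n).

Definition rows_of B : 'M[rat]_(size B, n) := \matrix_(i < size B) ratmx B`_i.

Lemma mem_rows_of B g : g \in B -> (ratmx g <= rows_of B)%MS.
Proof.
move=> gB; have iB : (index g B < size B)%N by rewrite index_mem.
by have := row_sub (Ordinal iB) (rows_of B); rewrite rowK/= nth_index.
Qed.

(** Clearing denominators turns a rational relation among the rows into an integral one. *)
Lemma Zindependent_row_free B : Zindependent B -> row_free (rows_of B).
Proof.
move=> indB; apply: inj_row_free => v vB.
have [D [D0 [w wE]]] := clear_denominators v.
pose c x := if insub (index x B) is Some i then w 0 i else 0.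
have cE (i : 'I_(size B)) : c B`_i = w 0 i.
  by rewrite /c index_uniq ?fset_uniq// (valK i : insub (val i) = Some i).
suff c0 : \sum_(x <- B) x *~ c x = 0.
  have w0 : w = 0.
    by apply/rowP => i; rewrite mxE -cE; apply: indB c0 _ _; exact: mem_nth.
  move: wE; rewrite w0 map_mx0 => /esym/eqP.
  by rewrite scaler_eq0 intr_eq0 (negbTE D0)/= => /eqP.
apply: ratmx_inj; rewrite map_mx0 (big_nth 0) big_mkord raddf_sum/=.
transitivity (ratmx w *m rows_of B).
  rewrite mulmx_sum_row; apply: eq_bigr => i _.
  by rewrite cE rowK mxE ratmxMz.
by rewrite wE -scalemxAl vB scaler0.
Qed.

Lemma Zindependent0 : Zindependent (fset0 : {fset 'rV[int]_n}).
Proof. by move=> c _ v; rewrite inE. Qed.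

Lemma Zindependent_fsetU1 B g : Zindependent B ->
  ~~ (ratmx g <= rows_of B)%MS -> Zindependent (g |` B)%fset.
Proof.
move=> indB gB c.
have gNB : g \notin B.
  by apply: contraNN gB; exact: mem_rows_of.
rewrite big_fsetU1//= => c0.
have cg : c g = 0.
  apply: contraNeq gB => cg.
  have <- : (c g)%:~R^-1 *: ((c g)%:~R *: ratmx g) = ratmx g.
    by rewrite scalerA mulVf ?scale1r// intr_eq0.
  rewrite scalemx_sub//.
  have -> : (c g)%:~R *: ratmx g = - ratmx (\sum_(v <- B) v *~ c v).
    apply/eqP; rewrite -addr_eq0; apply/eqP.
    transitivity (ratmx (g *~ c g + \sum_(v <- B) v *~ c v)); last first.
      by rewrite c0 map_mx0.
    by rewrite map_mxD ratmxMz.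
  rewrite eqmx_opp (big_nth 0) big_mkord raddf_sum/= summx_sub// => i _.
  have -> : ratmx (B`_i *~ c B`_i) = (c B`_i)%:~R *: row i (rows_of B).
    by rewrite rowK ratmxMz.
  by rewrite scalemx_sub// row_sub.
move=> v; rewrite in_fset1U => /orP[/eqP ->//|vB].
by apply: indB vB; move: c0; rewrite cg mulr0z add0r.
Qed.

(** The hypotheses make [V] the rational span of [G]. A maximal independent [B] spans [V], since
    otherwise some [g] in [G] could be added to it. *)
Lemma rank_span G p (V : 'M[rat]_(p, n)) :
  (forall x, G x -> (ratmx x <= V)%MS) ->
  (forall q (W : 'M[rat]_(q, n)), (forall x, G x -> (ratmx x <= W)%MS) ->
    (V <= W)%MS) ->
  rank G = \rank V.
Proof.
move=> GV spanV.
have rowsV B : [set` B] `<=` G -> (rows_of B <= V)%MS.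
  move=> BG; apply/row_subP => i; rewrite rowK; apply/GV/BG.
  by rewrite /= mem_nth.
have card_le B : [set` B] `<=` G -> Zindependent B -> (#|` B| <= \rank V)%N.
  move=> BG /Zindependent_row_free /eqP <-; exact/mxrankS/rowsV.
have card_max B : maximal_Zindependent G B -> #|` B| = \rank V.
  move=> [BG indB maxB]; apply/eqP; rewrite eqn_leq card_le//=.
  rewrite leqNgt; apply/negP => ltB.
  suff : (V <= rows_of B)%MS.
    by move/mxrankS; rewrite (eqP (Zindependent_row_free indB)) leqNgt ltB.
  apply: spanV => g Gg; apply/negP => /negP gB.
  have gNB : g \notin B.
    by apply: contraNN gB; exact: mem_rows_of.
  have BgB : B = (g |` B)%fset.
    apply/esym/maxB; last by move=> x /= xB; rewrite in_fset1U xB orbT.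
      by move=> x /=; rewrite in_fset1U => /orP[/eqP ->//|/BG].
    exact: Zindependent_fsetU1.
  by move: gNB; rewrite BgB fset1U1.
(* An independent subset of largest size is maximal; its existence rules out the default value of
   [xget]. *)
pose P k := `[< exists B, [/\ [set` B] `<=` G, Zindependent B & #|` B| = k] >].
have P0 : exists k, P k.
  exists 0%N; apply/asboolP; exists fset0.
  split; [by move=> x; rewrite /= inE| |exact: cardfs0].
  exact: Zindependent0.
have Pmax k : P k -> (k <= \rank V)%N.
  by move=> /asboolP[B [BG indB <-]]; exact: card_le.
case: (ex_maxnP P0 Pmax) => k /asboolP[B [BG indB Bk]] kmax.
have maxB : maximal_Zindependent G B.
  split=> // B' B'G indB' BB'; apply/eqP; rewrite eq_sym eqEfcard.
  apply/andP; split; first by apply/fsubsetP => x /BB'.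
  by rewrite Bk; apply: kmax; apply/asboolP; exists B'.
rewrite /rank; case: xgetP => [_ -> [B1 /card_max <-]//|/(_ #|` B|)].
by move=> /(_ _)[]; exists B.
Qed.

End Rank.

(** For a rational subspace [V], the integral constraint is applied to the group of integral points
    of [V]. Clearing denominators shows that they span [V] and that their images span the images of
    [V]. *)
Lemma rational_feasible (R : realType) (d m : nat) (dims : 'I_m -> nat)
    (phi : forall j : 'I_m, zaffine d (dims j)) (s : 'I_m -> R) :
  HBL_feasible phi s ->
  rank_feasible (fun j => ratmx (linear_part (phi j))) s.
Proof.
move=> [s01 feas]; split=> [j|V]; first by have /andP[] := s01 j.
pose S := [pred x : 'rV[int]_d | (ratmx x <= V)%MS].
have S_closed : GRing.zmod_closed S.
  split=> [|x y]; rewrite !inE; first by rewrite map_mx0 sub0mx.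
  by move=> xV yV; rewrite map_mxB addmx_sub// eqmx_opp.
pose H : zmodClosed 'rV[int]_d :=
  HB.pack (S : {pred _}) (GRing.isZmodClosed.Build _ _ S_closed).
have rankS q (Y : 'M[int]_(d, q)) :
    rank [set x *m Y | x in [set x | x \in H]] = \rank (V *m ratmx Y).
  apply: rank_span => [_ [x /= xV <-]|p W HW].
    by rewrite map_mxM submxMr.
  apply/row_subP => i; rewrite row_mul.
  have [D [D0 [w wE]]] := clear_denominators (row i V).
  have <- : D%:~R^-1 *: (ratmx w *m ratmx Y) = row i V *m ratmx Y.
    by rewrite wE -scalemxAl scalerA mulVf ?scale1r// intr_eq0.
  rewrite scalemx_sub// -map_mxM; apply: HW; exists w => //=.
  by rewrite inE/= wE scalemx_sub// row_sub.
have := feas H; under [leRHS]eq_bigr do rewrite rankS.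
suff -> : rank [set x | x \in H] = \rank V by [].
have := rankS _ 1%:M; rewrite map_mx1 mulmx1 => <-; congr rank.
apply/seteqP; split=> [x xH|_ [x xH <-]]; last by rewrite mulmx1.
by exists x => //; rewrite mulmx1.
Qed.

(** * Existence of the minimum *)

Lemma continuous_sum (R : realType) (T : topologicalType) (I : Type)
    (r : seq I) (F : I -> T -> R) :
  (forall i, continuous (F i)) -> continuous (fun x => \sum_(i <- r) F i x).
Proof.
move=> cF; elim: r => [|i r IH].
  by under eq_fun do rewrite big_nil; exact: cst_continuous.
under eq_fun do rewrite big_cons.
by move=> x; apply: continuousD; [exact: cF|exact: IH].
Qed.

Lemma closed_halfspace (R : realType) (m : nat) (a : R) (c : 'I_m -> R) :
  closed [set v : 'rV[R]_m | a <= \sum_(j < m) v 0 j * c j].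
Proof.
pose f (v : 'rV[R]_m) := \sum_(j < m) v 0 j * c j.
have cf : continuous f.
  apply: continuous_sum => j v; apply: continuousM; last exact: cst_continuous.
  exact: coord_continuous.
exact: (preimage_closed (D := [set x | a <= x]) (fun v _ => cf v)
  (@closed_ge _ a)).
Qed.

(** The feasible set is the unit cube cut by closed half-spaces, hence compact, and the objective is
    continuous. *)
Lemma exists_sHBL (R : realType) (d m : nat) (dims : 'I_m -> nat)
    (phi : forall j : 'I_m, zaffine d (dims j)) :
  (exists s : 'I_m -> R, HBL_feasible phi s) ->
  exists sHBL : R, is_sHBL phi sHBL.
Proof.
move=> [s0 feas0].
pose S := [set v : 'rV[R]_m | HBL_feasible phi (v 0)].
have cS : compact S.
  pose box := [set v : 'rV[R]_m | forall j, `[0, 1]%classic (v 0 j)].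
  have cbox : compact box.
    exact: (@rV_compact R m (fun=> `[0, 1]%classic)
      (fun=> @segment_compact _ 0 1)).
  apply: (subclosed_compact _ cbox); last first.
    by move=> v [v01 _] j; rewrite /= in_itv/=.
  pose half (r : nat * {ffun 'I_m -> nat}) :=
    [set v : 'rV[R]_m | r.1%:R <= \sum_(j < m) v 0 j * (r.2 j)%:R].
  pose ranks (H : zmodClosed 'rV[int]_d) : nat * {ffun 'I_m -> nat} :=
    (rank [set x | x \in H],
     [ffun j => rank [set x *m linear_part (phi j) | x in [set x | x \in H]]]).
  have ranksE H v : half (ranks H) v <-> (rank [set x | x \in H])%:R <=
      \sum_(j < m) v 0 j *
        (rank [set x *m linear_part (phi j) | x in [set x | x \in H]])%:R.
    by rewrite /half/=; under eq_bigr do rewrite ffunE.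
  have -> : S = box `&` \bigcap_(r in [set r | exists H, r = ranks H]) half r.
    apply/seteqP; split=> v.
      move=> [v01 vH]; split=> [j|_ [H ->]]; first by rewrite /= in_itv/=.
      exact/ranksE/vH.
    move=> [v01 vH]; split=> [j|H]; first by have := v01 j; rewrite /= in_itv/=.
    by apply/ranksE/vH; exists H.
  apply: closedI; first exact: compact_closed cbox.
  by apply: closed_bigI => r _; exact: closed_halfspace.
have S0 : S !=set0.
  exists (\row_j s0 j); rewrite /S/=.
  have -> // : (\row_j s0 j) 0 = s0 by apply/funext => j; rewrite mxE.
pose f (v : 'rV[R]_m) := \sum_(j < m) v 0 j.
have cf : continuous f.
  by apply: continuous_sum => j; exact: coord_continuous.
have [v vS vmin] := compact_EVT_min S0 cS (continuous_subspaceT cf).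
exists (f v); split; first by exists (v 0) => //; move: vS; rewrite inE.
move=> _ [s feas <-]; have := vmin (\row_j s j).
have -> : f (\row_j s j) = \sum_j s j by apply: eq_bigr => j _; rewrite mxE.
apply; rewrite inE /S/=.
by have -> // : (\row_j s j) 0 = s by apply/funext => j; rewrite mxE.
Qed.

(** * Array variables in a segment of an execution *)

Lemma onth_size (T : Type) (s : seq T) i e : onth s i = Some e -> (i < size s)%N.
Proof. by elim: s i => [|x s IH] [|i]//= /IH. Qed.

Lemma take_onth (T : Type) (s : seq T) i e :
  onth s i = Some e -> take i.+1 s = rcons (take i s) e.
Proof.
elim: s i => [|x s IH] [|i]//=; first by case=> ->; rewrite take0.
by move=> /IH <-.
Qed.

Lemma take_onth_None (T : Type) (s : seq T) i :
  onth s i = None -> take i.+1 s = take i s.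
Proof. by elim: s i => [|x s IH] [|i]//= /IH ->. Qed.

Section Residency.
Variable V : choiceType.
Implicit Types (E : execution V) (v : V).

Lemma resident_rcons E e v : resident (rcons E e) v =
  match e with
  | Read w | Allocate w => (w == v) || resident E v
  | Write w | Free w => (w != v) && resident E v
  | Compute _ => resident E v
  end.
Proof. by rewrite /resident foldl_rcons; case: e. Qed.

Lemma enter_resident E i k v : enters_at E i v -> (i < k)%N ->
  (forall l, (i < l < k)%N -> ~ leaves_at E l v) -> resident (take k E) v.
Proof.
move=> Ei; elim: k => // k IH; rewrite ltnS leq_eqVlt => /predU1P[<- _|ik stay].
  by case: Ei => Ei; rewrite (take_onth Ei) resident_rcons eqxx.
have {}IH : resident (take k E) v.
  by apply: IH => // l /andP[il lk]; apply: stay; rewrite il ltnS ltnW.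
case Ek: (onth E k) => [e|]; last by rewrite (take_onth_None Ek).
have stayk : ~ leaves_at E k v by apply: stay; rewrite ik ltnS leqnn.
rewrite (take_onth Ek) resident_rcons.
case: e Ek => [w|w|B|w|w] Ek; rewrite IH ?orbT// andbT; apply/eqP => wv;
  by apply: stayk; rewrite /leaves_at Ek wv; first [by left|by right].
Qed.

Lemma paired_resident E i k v a :
  paired E i k v -> (i < a <= k)%N -> resident (take a E) v.
Proof.
move=> [ik Ei Ek apart] /andP[ia ak]; apply: (enter_resident Ei ia).
move=> l /andP[il la]; have := apart l; rewrite il (leq_trans la ak).
by move=> /(_ isT) H leave; apply: H; right.
Qed.

Lemma leaves_size E k v : leaves_at E k v -> (k < size E)%N.
Proof. by case=> Ek; exact: onth_size Ek. Qed.

Lemma reads_writes_take E i j :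
  (i <= j)%N -> (reads_writes (take i E) <= reads_writes (take j E))%N.
Proof.
by move=> ij; rewrite -(subnKC ij) takeD /reads_writes count_cat leq_addr.
Qed.

Lemma reads_writes_take_le E i : (reads_writes (take i E) <= reads_writes E)%N.
Proof. by rewrite -{2}(cat_take_drop i E) /reads_writes count_cat leq_addr. Qed.

End Residency.

Lemma card_fset1U_le (K : choiceType) (x : K) (F : {fset K}) (z : int) :
  #|` F|%:Z <= z -> #|` (x |` F)%fset|%:Z <= z + 1.
Proof. by rewrite cardfsU1; case: (x \notin F) => /=; lia. Qed.

Lemma card_fsetD1_le (K : choiceType) (x : K) (F : {fset K}) (z : int) :
  x \in F -> #|` F|%:Z <= z -> #|` (F `\ x)%fset|%:Z <= z - 1.
Proof. by move=> xF; rewrite (cardfsD1 x F) xF; lia. Qed.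

Section Segments.
Variables (slow fast : choiceType).
Let V := variable slow fast.
Variables (M : nat) (E : execution V).
Hypothesis fit : M_fit M E.

Lemma leaves_resident k v : leaves_at E k v -> resident (take k E) v.
Proof.
move=> lv; have [i pr] := wf_leave_paired fit.1 lv; have [ik _ _ _] := pr.
by apply: (paired_resident pr); rewrite ik leqnn.
Qed.

(** Entering adds at most one element to [F]. A variable that leaves is resident by pairing, so its
    removal does lower the cardinality. The strict bound avoids the end of [E], where the footprint
    is 0 by definition. *)
Lemma resident_footprint i : (i < size E)%N ->
  exists2 F : {fset V}, (forall v, resident (take i E) v -> v \in F)
    & #|` F|%:Z <= footprint E i.
Proof.
elim: i => [_|i IH iE].
  by exists fset0 => [v|]; rewrite ?take0// cardfs0.
have [F resF cardF] := IH (ltnW iE).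
rewrite /= (ltn_eqF iE).
case Ei: (onth E i) => [e|]; last first.
  by exists F; rewrite ?(take_onth_None Ei)// addr0.
rewrite (take_onth Ei); case: e Ei => [w|w|B|w|w] Ei.
- exists (w |` F)%fset => [v|].
    rewrite resident_rcons in_fset1U eq_sym => /orP[->//|/resF ->].
    by rewrite orbT.
  exact: card_fset1U_le.
- have wF : w \in F by apply/resF/leaves_resident; left.
  exists (F `\ w)%fset => [v|].
    by rewrite resident_rcons in_fsetD1 eq_sym => /andP[-> /resF].
  exact: card_fsetD1_le.
- by exists F; rewrite ?addr0// => v; rewrite resident_rcons; exact: resF.
- exists (w |` F)%fset => [v|].
    rewrite resident_rcons in_fset1U eq_sym => /orP[->//|/resF ->].
    by rewrite orbT.
  exact: card_fset1U_le.
- have wF : w \in F by apply/resF/leaves_resident; right.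
  exists (F `\ w)%fset => [v|].
    by rewrite resident_rcons in_fsetD1 eq_sym => /andP[-> /resF].
  exact: card_fsetD1_le.
Qed.

Lemma resident_card i : (i < size E)%N ->
  exists2 F : {fset V}, (forall v, resident (take i E) v -> v \in F)
    & (#|` F| <= M)%N.
Proof.
move=> iE; have [F resF cardF] := resident_footprint iE; exists F => //.
by have := le_trans cardF (fit.2 i (ltnW iE)); rewrite lez_nat.
Qed.

Definition segment i : nat := (reads_writes (take i E) %/ M)%N.

Lemma segment_le i j : (i <= j)%N -> (segment i <= segment j)%N.
Proof. by move=> ij; apply/leq_div2r/reads_writes_take. Qed.

Lemma segment_le_last i : (segment i <= reads_writes E %/ M)%N.
Proof. exact/leq_div2r/reads_writes_take_le. Qed.

(** All these variables are resident just before the first statement whose segment is at least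
    [q]. *)
Lemma crossing_card q :
  exists2 F : {fset V}, (forall i k v, paired E i k v ->
    (segment i < q)%N -> (q <= segment k)%N -> v \in F) & (#|` F| <= M)%N.
Proof.
pose P a := (a < size E)%N && (q <= segment a)%N.
have [[a0 Pa0]|noP] := pselect (exists a, P a); last first.
  exists fset0; last by rewrite cardfs0.
  move=> i k v [_ _ Ek _] _ qk; case: noP; exists k.
  by rewrite /P (leaves_size Ek).
case: (ex_minnP (ex_intro _ a0 Pa0)) => a /andP[aE qa] amin.
have [F resF cardF] := resident_card aE; exists F => // i k v pr iq qk.
apply: resF; apply: (paired_resident pr); apply/andP; split.
  rewrite ltnNge; apply/negP => /segment_le; lia.
by have [_ _ Ek _] := pr; apply: amin; rewrite /P (leaves_size Ek).
Qed.

Lemma transfer_card q : (0 < M)%N ->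
  exists2 F : {fset V}, (forall i v, segment i = q ->
    onth E i = Some (Read v) \/ onth E i = Some (Write v) -> v \in F)
    & (#|` F| <= M)%N.
Proof.
move=> M0.
(* The last bound carries the induction: a transfer in segment [q] is preceded by fewer than
   [q * M + M] transfers. The truncated subtraction gives 0 before segment [q] starts. *)
have H n : exists F : {fset V}, [/\ forall i v, (i < n)%N -> segment i = q ->
      onth E i = Some (Read v) \/ onth E i = Some (Write v) -> v \in F,
    (#|` F| <= M)%N & (#|` F| <= reads_writes (take n E) - q * M)%N].
  elim: n => [|n [F [FV FM Fq]]].
    by exists fset0; rewrite cardfs0.
  have le_rw := reads_writes_take E (leqnSn n).
  have [[v [Ev sq]]|no] := pselect (exists v, (onth E n = Some (Read v) \/
      onth E n = Some (Write v)) /\ segment n = q); last first.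
    exists F; split=> //; last by lia.
    move=> i v; rewrite ltnS leq_eqVlt => /predU1P[->|]; last exact: FV.
    by move=> sq Ev; case: no; exists v.
  have rwS : reads_writes (take n.+1 E) = (reads_writes (take n E)).+1.
    case: Ev => Ev; rewrite (take_onth Ev) /reads_writes -cats1 count_cat/=; lia.
  have /andP[qM Mq] : (q * M <= reads_writes (take n E) < q * M + M)%N.
    rewrite -sq /segment {2 3}(divn_eq (reads_writes (take n E)) M).
    by rewrite leq_addr ltn_add2l ltn_mod.
  have cardU : (#|` (v |` F)%fset| <= #|` F| + 1)%N.
    by rewrite -lez_nat PoszD card_fset1U_le.
  exists (v |` F)%fset; split; last 2 first.
  - by apply: leq_trans cardU _; lia.
  - by apply: leq_trans cardU _; lia.
  move=> i w; rewrite ltnS leq_eqVlt => /predU1P[->|iln] si Ew; last first.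
    by rewrite in_fset1U (FV _ _ iln si Ew) orbT.
  suff -> : w = v by exact: fset1U1.
  by case: Ev => Ev; move: Ew; rewrite Ev => -[] [].
have [F [FV FM _]] := H (size E); exists F => // i v si Ev.
by apply: (FV i v _ si Ev); case: Ev => Ev; exact: onth_size Ev.
Qed.

(* A variable used in segment [q] is resident when the segment starts, resident
   when it ends, or read or written during it: an array variable that is both
   allocated and discarded inside the segment has to be written. *)
Lemma segment_operands_card (P : V -> Prop) q :
  (0 < M)%N -> no_paired_Allocate_Free P E ->
  exists2 F : {fset V}, (forall p B v, onth E p = Some (Compute B) -> v \in B ->
    P v -> segment p = q -> v \in F) & (#|` F| <= 3 * M)%N.
Proof.
move=> M0 noAF.
have [F1 F1V F1M] := crossing_card q; have [F2 F2V F2M] := transfer_card q M0.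
have [F3 F3V F3M] := crossing_card q.+1.
exists (F1 `|` F2 `|` F3)%fset; last first.
  have cardU (X Y : {fset V}) : (#|` (X `|` Y)%fset| <= #|` X| + #|` Y|)%N.
    by rewrite cardfsU leq_subr.
  apply: leq_trans (cardU _ _) _; rewrite mulSn addnC leq_add//.
  by apply: leq_trans (cardU _ _) _; rewrite mul2n -addnn leq_add.
move=> p B v Ep vB Pv pq.
have [i [k [pr /andP[ip pk]]]] := wf_compute fit.1 Ep vB.
have iq : (segment i <= q)%N by rewrite -pq segment_le// ltnW.
have qk : (q <= segment k)%N by rewrite -pq segment_le// ltnW.
rewrite !in_fsetU.
move: iq; rewrite leq_eqVlt => /predU1P[iq|iq]; last by rewrite (F1V _ _ _ pr).
have [_ [Ei|Ei] Ek _] := pr; first by rewrite (F2V i v) ?orbT//; left.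
case: Ek => Ek; last by case: (noAF _ _ _ Pv pr).
move: qk; rewrite leq_eqVlt => /predU1P[qk|qk].
  by rewrite (F2V k v) ?orbT//; right.
by rewrite (F3V _ _ _ pr) ?orbT// iq.
Qed.

End Segments.

(** * Chunks as intervals of statement positions *)

Lemma compute_operands_cat (V : choiceType) (E : execution V) l1 l2 :
  compute_operands E = l1 ++ l2 -> exists E1 E2,
    [/\ E = E1 ++ E2, compute_operands E1 = l1 & compute_operands E2 = l2].
Proof.
elim: E l1 => [|e E IH] l1.
  by case: l1 => //= <-; exists [::], [::].
case: l1 => [|b l1]; first by move=> /= <-; exists [::], (e :: E).
case: e => [w|w|B|w|w] /=.
1,2,4,5: by move=> /(IH (b :: l1))[E1 [E2 [-> H1 H2]]];
  match goal with |- exists E1 E2, [/\ ?e :: _ = _, _ & _] =>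
    exists (e :: E1), E2 end.
by case=> -> /IH[E1 [E2 [-> H1 H2]]]; exists (Compute b :: E1), E2; rewrite /= H1.
Qed.

Lemma mem_compute_operands (V : choiceType) (E : execution V) B :
  B \in compute_operands E -> exists p, onth E p = Some (Compute B).
Proof.
elim: E => // e E IH; case: e => [w|w|C|w|w] /=.
1,2,4,5: by move=> /IH[p Ep]; exists p.+1.
by rewrite inE => /predU1P[->|/IH[p Ep]]; [exists 0%N|exists p.+1].
Qed.

(** Each cut between chunks of Computes lifts to a cut of the whole execution, so chunk [c] lies in
    the positions from [b c] up to [b c.+1], the latter excluded. *)
Lemma chunk_cuts (V : choiceType) (E : execution V) (chs : seq (seq {fset V})) :
  flatten chs = compute_operands E ->
  exists b : nat -> nat, (forall c, (b c <= b c.+1)%N) /\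
    forall c B, B \in nth [::] chs c ->
      exists2 p, (b c <= p < b c.+1)%N & onth E p = Some (Compute B).
Proof.
elim: chs E => [|ch chs IH] E /=.
  by move=> _; exists (fun=> 0%N); split=> // c B; rewrite nth_nil.
move/esym/compute_operands_cat => [E1 [E2 [-> co1 /esym/IH[b [bmono bV]]]]].
exists (fun c => if c is c'.+1 then size E1 + b c' else 0)%N; split.
  by case=> [|c]; rewrite ?leq_add2l.
case=> [|c] B /=.
  rewrite -co1 => /mem_compute_operands[p Ep]; exists p.
    by rewrite (leq_trans (onth_size Ep)) ?leq_addr.
  elim: E1 {co1} p Ep => [|e E1 IH1] [|p]//=; exact: IH1.
move=> /bV[p bp Ep]; exists (size E1 + p)%N; first by rewrite leq_add2l ltn_add2l.
by elim: E1 {co1}.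
Qed.

(** * Counting iterations *)

(** The entropy inequality for [x] on [D]: injectivity of [x] makes the left side [#|D| * ln #|D|],
    and each projection takes at most [#|F|] values. A single [F] serves all arrays, which allows
    aliasing. *)
Lemma card_HBL (R : realType) (d m : nat) (dims : 'I_m -> nat)
    (phi : forall j : 'I_m, zaffine d (dims j)) (s : 'I_m -> R)
    (V : choiceType) (f : forall j : 'I_m, 'rV[int]_(dims j) -> V)
    (T : finType) (D : {set T}) (x : T -> 'rV[int]_d) (F : {fset V}) :
  HBL_feasible phi s -> (forall j, set_inj (range (phi j)) (f j)) ->
  {in D &, injective x} ->
  (forall t j, t \in D -> f j (phi j (x t)) \in F) ->
  #|D|%:R <= #|` F|%:R `^ (\sum_j s j).
Proof.
move=> feas finj xinj xF.
have [->|[t0 t0D]] := set_0Vmem D; first by rewrite cards0 powR_ge0.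
have s0 j : 0 <= s j by have /andP[] := feas.1 j.
have D0 : 0 < #|D|%:R :> R by rewrite ltr0n; apply/card_gt0P; exists t0.
have := entropy_HBL (rational_feasible feas) D (fun t => ratmx (x t)).
rewrite (@entropy_inj R T _ D); last by move=> t u tD uD /ratmx_inj; exact: xinj.
(* Without arrays [F] may be empty; the entropy bound then gives [#|D| <= 1]. *)
have [m0|/card_gt0P[j0 _]] := posnP #|'I_m|.
  have sum0 (G : 'I_m -> R) : \sum_j G j = 0.
    by rewrite big1// => j; have := card0_eq m0 j; rewrite inE.
  rewrite !sum0 pmulr_rle0// powRr0 => lnD.
  by rewrite leNgt; apply/negP => /ln_gt0; rewrite ltNge lnD.
have F0 : 0 < #|` F|%:R :> R.
  rewrite ltr0n cardfs_gt0; apply/fset0Pn.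
  by exists (f j0 (phi j0 (x t0))); exact: xF.
have entF j : entropy R D (fun t => ratmx (x t) *m ratmx (linear_part (phi j))) <=
    #|D|%:R * ln #|` F|%:R.
  apply: le_trans (@entropy_le_card R T V D (fun t => f j (phi j (x t))) F _).
    (* Neither the translation in [phi j] nor the injection [f j] changes the fibers. *)
    rewrite le_eqVlt; apply/orP; left; apply/eqP; apply: eq_entropy => t u tD uD.
    rewrite -!map_mxM; have rng v : phi j (x v) \in range (phi j).
      by apply/mem_set; exists (x v).
    apply/eqP/eqP => [/ratmx_inj e|]; first by rewrite /zaffine_fun e.
    by move=> /(finj j _ _ (rng t) (rng u))/addIr ->.
  by move=> t tD; exact: xF.
move=> /le_trans /(_ (ler_sum _ (fun j _ => ler_wpM2l (s0 j) (entF j)))).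
under eq_bigr do rewrite mulrCA.
rewrite -mulr_sumr ler_pM2l// -mulr_suml => le_ln.
by rewrite -ler_ln ?posrE ?powR_gt0// ln_powR.
Qed.

Lemma sum_steps (g : nat -> nat) N : (forall c, (g c <= g c.+1)%N) ->
  (\sum_(c < N) (g c < g c.+1) + g 0 <= g N)%N.
Proof.
move=> gmono; elim: N => [|N IH]; first by rewrite big_ord0.
rewrite big_ord_recr/=; move: (gmono N) IH; set S := (\sum_(c < N) _)%N.
by have [|_] := ltnP (g N) (g N.+1) => /= *; lia.
Qed.

(* [g] jumps at most [Q] times, and every other index stays within one level. *)
Lemma sum_levels (g : nat -> nat) N Q cap :
  (forall c, (g c <= g c.+1)%N) -> (forall c, (g c <= Q)%N) ->
  (forall q, (#|[set c : 'I_N | (g c == q) && (g c.+1 == q)]%SET| <= cap)%N) ->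
  (N <= Q + Q.+1 * cap)%N.
Proof.
move=> gmono gQ capP.
have step : (\sum_(c < N) (g c < g c.+1) <= Q)%N.
  by have := sum_steps N gmono; have := gQ N; lia.
apply: (@leq_trans (\sum_(c < N) ((g c < g c.+1) +
    \sum_(q < Q.+1) (c \in [set c : 'I_N | (g c == q) && (g c.+1 == q)]%SET)))).
  rewrite -[X in (X <= _)%N]card_ord -sum1_card; apply: leq_sum => c _.
  have [//|ge] := ltnP (g c) (g c.+1).
  have e : g c.+1 = g c by apply/eqP; rewrite eqn_leq ge gmono.
  have gcQ : (g c < Q.+1)%N by rewrite ltnS.
  by rewrite (bigD1 (Ordinal gcQ))//= inE e eqxx.
rewrite big_split/= leq_add// exchange_big/=.
rewrite -[X in (_ <= X * _)%N]card_ord -sum_nat_const; apply: leq_sum => q _.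
by rewrite -big_mkcond sum1_card.
Qed.

Section Counting.
Variables (R : realType) (d m : nat) (dims : 'I_m -> nat).
Variables (phi : forall j : 'I_m, zaffine d (dims j)) (s : 'I_m -> R).
Hypotheses (m_gt0 : (0 < m)%N) (feas : HBL_feasible phi s).
Variables (slow fast : choiceType) (Z : {fset 'rV[int]_d}).
Variable A : forall j : 'I_m, 'rV[int]_(dims j) -> variable slow fast.
Variables (M : nat) (E : execution (variable slow fast)).
Hypotheses (Ainj : forall j, set_inj (range (phi j)) (@A j)).
Hypotheses (fit : M_fit M E) (legalE : legal phi Z (@A) E).
Hypothesis noAF : no_paired_Allocate_Free (array_variable phi Z (@A)) E.

Lemma iteration_cuts : exists (b : nat -> nat) (x : 'I_(#|` Z|) -> 'rV[int]_d),
  [/\ forall c, (b c <= b c.+1)%N, injective x, forall c, x c \in Z &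
    forall (c : 'I_(#|` Z|)) j, exists p (B : {fset variable slow fast}),
      [/\ (b c <= p < b c.+1)%N, onth E p = Some (Compute B)
        & @A j (phi j (x c)) \in B]].
Proof.
have [chunks [permZ flatE opE]] := legalE.
have [b [bmono bV]] := chunk_cuts flatE.
have szZ : size chunks = #|` Z| by rewrite -(size_map fst) (perm_size permZ).
have ltc (c : 'I_(#|` Z|)) : (c < size chunks)%N by rewrite szZ.
exists b, (fun c => nth 0 (unzip1 chunks) c); split=> //.
- move=> c c' /eqP; rewrite nth_uniq ?size_map// => [/eqP/val_inj//|].
  by rewrite (perm_uniq permZ) fset_uniq.
- by move=> c; rewrite -(perm_mem permZ) mem_nth ?size_map.
move=> c j; pose ch := nth (0, [::]) chunks c.
have [B Bch AB] : exists2 B, B \in ch.2 & @A j (phi j ch.1) \in B.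
  by apply: (opE ch.1 ch.2); rewrite -surjective_pairing mem_nth.
have [p bp Ep] : exists2 p, (b c <= p < b c.+1)%N & onth E p = Some (Compute B).
  by apply: bV; rewrite (nth_map (0, [::])).
by exists p, B; split=> //; rewrite (nth_map (0, [::])).
Qed.

Lemma fast_memory_gt0 : Z != fset0 -> (0 < M)%N.
Proof.
rewrite -cardfs_gt0 => Z0; have [b [x [_ _ _ opE]]] := iteration_cuts.
have [p [B [_ Ep AB]]] := opE (Ordinal Z0) (Ordinal m_gt0).
have [i [k [pr /andP[ip pk]]]] := wf_compute fit.1 Ep AB.
have [F resF cardF] := resident_card fit (onth_size Ep).
apply: leq_trans cardF; rewrite cardfs_gt0; apply/fset0Pn.
by eexists; apply/resF/(paired_resident pr); rewrite ip ltnW.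
Qed.

Lemma iterations_le : (0 < M)%N ->
  #|` Z|%:R <= (reads_writes E %/ M).+1%:R *
    ((3 `^ (\sum_j s j) + 1) * M%:R `^ (\sum_j s j)) :> R.
Proof.
move=> M0; set S := \sum_j s j; set Q := (reads_writes E %/ M)%N.
have S0 : 0 <= S by apply: sumr_ge0 => j _; have /andP[] := feas.1 j.
have [b [x [bmono xinj xZ opE]]] := iteration_cuts.
(* Iteration [c] runs within segments [g c] to [g c.+1]; if these agree, all its accesses fall in
   one segment. *)
pose g c := segment M E (b c).
have gmono c : (g c <= g c.+1)%N by exact: segment_le.
pose cap := Num.truncn ((3 * M)%:R `^ S : R).
have capP q :
    (#|[set c : 'I_(#|` Z|) | (g c == q) && (g c.+1 == q)]%SET| <= cap)%N.
  set D := [set c | _]%SET.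
  have [F FV FM] := segment_operands_card fit q M0 noAF.
  rewrite truncn_ge_nat ?powR_ge0//.
  have DF : #|D|%:R <= #|` F|%:R `^ S.
    apply: (card_HBL feas Ainj (x := x)) => [c c' _ _|c j]; first exact: xinj.
    rewrite inE => /andP[/eqP gc /eqP gc1].
    have [p [B [/andP[bp pb] Ep AB]]] := opE c j.
    apply: FV Ep AB _ _; first by exists (x c), j.
    apply/eqP; rewrite eqn_leq -{1}gc1 -gc.
    by rewrite !segment_le// ltnW.
  apply: le_trans DF _; apply: ge0_ler_powR => //; rewrite ?nnegrE//.
  by rewrite ler_nat.
have := sum_levels gmono (fun c => segment_le_last M E (b c)) capP.
rewrite -/Q -(ler_nat R) natrD natrM => /le_trans; apply.
(* This absorbs the iterations cut by segment boundaries, and is the source of the summand 1 next to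
   [3 ^ S]. *)
have M1 : 1 <= M%:R `^ S.
  by have := @ler_powR R M%:R _ _ _ S0; rewrite powRr0 ler1n; exact.
have capM : cap%:R <= 3 `^ S * M%:R `^ S :> R.
  by rewrite -powRM// -natrM truncn_le powR_ge0.
have : Q.+1%:R * cap%:R <= Q.+1%:R * (3 `^ S * M%:R `^ S) :> R.
  by rewrite ler_wpM2l.
have : Q%:R <= Q.+1%:R * M%:R `^ S :> R.
  by apply: le_trans (ler_peMr _ M1); rewrite ?ler_nat.
lra.
Qed.

Lemma reads_writes_lower_bound :
  2 * (3 `^ (\sum_j s j) + 1) * M%:R `^ (\sum_j s j) <= #|` Z|%:R ->
  (2 * (3 `^ (\sum_j s j) + 1))^-1 *
    (#|` Z|%:R / M%:R `^ (\sum_j s j - 1)) <= (reads_writes E)%:R.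
Proof.
set S := \sum_j s j => large.
have [->|Z0] := eqVneq Z fset0; first by rewrite cardfs0 mul0r mulr0.
have M0 := fast_memory_gt0 Z0; have MR : 0 < M%:R :> R by rewrite ltr0n.
have := iterations_le M0; rewrite -/S => leZ.
have MS : 0 < M%:R `^ S by rewrite powR_gt0.
have C0 : 0 < 3 `^ S + 1 :> R by have := powR_ge0 3 S; lra.
have -> : M%:R `^ (S - 1) = M%:R `^ S / M%:R.
  by rewrite powRB ?powRr1 ?ltW// (gt_eqF MR) implybT.
rewrite mulrC ler_pdivrMr ?mulr_gt0// invf_div mulrA ler_pdivrMr//.
have QM : (reads_writes E %/ M)%:R * M%:R <= (reads_writes E)%:R :> R.
  by rewrite -natrM ler_nat leq_trunc_div.
move: leZ; rewrite -natr1 mulrDl mul1r => leZ.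
set C := 3 `^ S + 1 in leZ large C0 *.
(* The possibly incomplete last segment accounts for at most half of [Z] by [large], which is where
   the factor 2 comes from. *)
have half : #|` Z|%:R <= (reads_writes E %/ M)%:R * (2 * (C * M%:R `^ S)) by lra.
apply: (@le_trans _ _ ((reads_writes E %/ M)%:R * (2 * (C * M%:R `^ S)) * M%:R)).
  by rewrite ler_wpM2r// ltW.
rewrite mulrAC -!mulrA mulrA ler_pM2r//.
by rewrite mulr_gt0// mulr_gt0.
Qed.

End Counting.

Theorem theorem4p1 (R : realType) (d m : nat) (d_gt0 : (0 < d)%N)
    (m_gt0 : (0 < m)%N) (dims : 'I_m -> nat)
    (phi : forall j : 'I_m, zaffine d (dims j))
    (feasible : exists s : 'I_m -> R, HBL_feasible phi s) :
  exists sHBL : R, is_sHBL phi sHBL /\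
  exists c K : R, 0 < c /\
  forall (slow fast : choiceType) (Z : {fset 'rV[int]_d})
    (A : forall j : 'I_m, 'rV[int]_(dims j) -> variable slow fast)
    (M : nat) (E : execution (variable slow fast)),
    (forall j : 'I_m, set_inj (range (phi j)) (A j)) ->
    M_fit M E ->
    legal phi Z A E ->
    no_paired_Allocate_Free (array_variable phi Z A) E ->
    K * M%:R `^ sHBL <= #|` Z|%:R ->
    c * (#|` Z|%:R / M%:R `^ (sHBL - 1)) <= (reads_writes E)%:R.
Proof.
have [sHBL sHBLP] := exists_sHBL feasible; exists sHBL; split=> //.
have [[s feas <-] _] := sHBLP.
(* Here [s] is a minimiser, so both constants depend on the value [sHBL] alone and are uniform in
   [Z], [A], [M] and [E]. *)
exists (2 * (3 `^ (\sum_j s j) + 1))^-1, (2 * (3 `^ (\sum_j s j) + 1)); split.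
  by rewrite invr_gt0 mulr_gt0// ltr_wpDl// powR_ge0.
move=> slow fast Z A M E Ainj fit legalE noAF.
exact: (reads_writes_lower_bound m_gt0 feas Ainj fit legalE noAF).
Qed.
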